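(* Let $R$ be a ring with unity and let $\mathcal{U}$ be a subcategory of the category $\operatorname{Mod}R$ of left $R$-modules. Let $F:\operatorname{Mod}R\to\operatorname{Mod}R$ be an additive functor with a natural transformation $\eta:\operatorname{id}\to F$ such that for each $M\in\mathcal{U}$ the natural map $\eta_M:M\to F(M)$ is an injection. Assume that $R\in\mathcal{U}$ and that $\mathcal{U}$ is closed under finite direct sums. The following are equivalent: (i) For every $M\in\mathcal{U}$, the map $\eta_M:M\to F(M)$ is an isomorphism. (ii) Every module $M$ in $\mathcal{U}$ is trace in $F(M)$ via $\eta_M:M\to F(M)$.
   Context: $R$ is not necessarily commutative; modules are left modules. For $R$-modules $M,X$, the trace module of $M$ in $X$ is $\tau_M(X)=\sum_{\alpha\in\operatorname{Hom}_R(M,X)}\alpha(M)\subseteq X$. A submodule $M\subseteq X$ is a trace submodule of $X$ if $M=\tau_N(X)$ for some $R$-module $N$. For an injective $R$-homomorphism $\iota:M\to X$, $M$ is trace in $X$ via $\iota$ if $\operatorname{Im}(\iota)$ is a trace submodule of $X$. *)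

(* Defs.v *)
From mathcomp Require Import all_boot all_order all_algebra.
From mathcomp Require Import boolp classical_sets.

Set Implicit Arguments.
Unset Strict Implicit.
Unset Printing Implicit Defensive.

Import GRing.Theory.

Local Open Scope classical_set_scope.
Local Open Scope ring_scope.

Section Defs.
(* Not necessarily commutative; the zero ring is allowed. *)
Variable R : pzRingType.

(* Not assumed to be full, nor closed under isomorphism. *)
Record subcategory := Subcategory {
  sub_ob :> lmodType R -> Prop;
  sub_hom : forall M N : lmodType R, {linear M -> N} -> Prop;
  sub_hom_ob : forall (M N : lmodType R) (f : {linear M -> N}),
    sub_hom f -> sub_ob M /\ sub_ob N;
  sub_hom_id : forall M : lmodType R,
    sub_ob M -> sub_hom (idfun : {linear M -> M});
  sub_hom_comp : forall (L M N : lmodType R)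
      (g : {linear M -> N}) (f : {linear L -> M}),
    sub_hom g -> sub_hom f -> sub_hom (g \o f : {linear L -> N})
}.

Record additive_functor := AdditiveFunctor {
  functor_ob :> lmodType R -> lmodType R;
  functor_map : forall M N : lmodType R,
    {linear M -> N} -> {linear functor_ob M -> functor_ob N};
  functor_id : forall M : lmodType R,
    functor_map (idfun : {linear M -> M}) =1 idfun;
  functor_comp : forall (L M N : lmodType R)
      (g : {linear M -> N}) (f : {linear L -> M}),
    functor_map (g \o f : {linear L -> N}) =1 functor_map g \o functor_map f;
  functor_add : forall (M N : lmodType R) (f g : {linear M -> N}),
    functor_map (f \+ g : {linear M -> N})
      =1 functor_map f \+ functor_map g
}.

(* Natural transformations from the identity functor to F. *)
Record nat_trans_from_id (F : additive_functor) := NatTransFromId {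
  component :> forall M : lmodType R, {linear M -> F M};
  naturality : forall (M N : lmodType R) (f : {linear M -> N}),
    component N \o f =1 functor_map F f \o component M
}.

Definition is_isomorphism (M N : lmodType R) (f : {linear M -> N}) : Prop :=
  exists g : {linear N -> M}, cancel f g /\ cancel g f.

(* P, with the maps inj, is the direct sum of the finite family M: the
   canonical map from the product of the family to P is a bijection. *)
Definition is_direct_sum (n : nat) (M : 'I_n -> lmodType R) (P : lmodType R)
    (inj : forall i, {linear M i -> P}) : Prop :=
  bijective (fun m : forall i, M i => \sum_(i < n) inj i (m i)).

(* Only nonempty families are required to have a direct sum in U, so that the
   zero module need not belong to U. *)
Definition closed_under_finite_direct_sums (U : subcategory) : Prop :=
  forall (n : nat) (M : 'I_n.+1 -> lmodType R), (forall i, U (M i)) ->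
    exists (P : lmodType R) (inj : forall i, {linear M i -> P}),
      U P /\ is_direct_sum inj.

(* The sum of the submodules alpha(M): the set of all finite sums of elements
   of these submodules. *)
Definition trace_module (M X : lmodType R) : set X :=
  [set x | exists (n : nat) (alpha : 'I_n -> {linear M -> X}) (m : 'I_n -> M),
     x = \sum_(i < n) alpha i (m i)].

Arguments trace_module : clear implicits.

Definition is_trace_submodule (X : lmodType R) (A : set X) : Prop :=
  exists N : lmodType R, A = trace_module N X.

(* Used for injective iota only. *)
Definition is_trace_via (M X : lmodType R) (iota : {linear M -> X}) : Prop :=
  is_trace_submodule (range iota).

End Defs.

(* Main.v *)
(* If M -> X is trace and injective, then composing any map M -> X with the
   inverse of M -> im M shows that every map M -> X lands in im M.  Given x in
   F(M), let P be the direct sum of M and R, and consider the map P -> F(P)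
   that projects to R and sends 1 to the image of x under F(M) -> F(P).  As P
   is trace in F(P), this image is eta_P(p) for some p; projecting back to F(M)
   shows that x is in the image of eta_M. *)
Require Import Defs.
From mathcomp Require Import all_boot all_order all_algebra.
From mathcomp Require Import boolp classical_sets.
From HB Require Import structures.

Set Implicit Arguments.
Unset Strict Implicit.
Unset Printing Implicit Defensive.

Import GRing.Theory.

Local Open Scope classical_set_scope.
Local Open Scope ring_scope.

(** [functor_map] acts on bundled linear maps, so pointwise equality has to be lifted to equality of
    the bundles. *)
Lemma eq_linear (R : pzRingType) (M N : lmodType R) (f g : {linear M -> N}) :
  f =1 g -> f = g.
Proof.
case: f g => f [[addf] [scf]] [g [[addg] [scg]]] /= /funext fg.
case: _ / fg addg scg => addg scg.
by rewrite (Prop_irrelevance addf addg) (Prop_irrelevance scf scg).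
Qed.

Lemma ex_linear (R : pzRingType) (M N : lmodType R) (f : M -> N) :
  linear f -> exists g : {linear M -> N}, g =1 f.
Proof.
move=> lin_f.
pose fL := GRing.isLinear.Build R M N *:%R f lin_f.
pose g : {linear M -> N} := HB.pack f fL.
by exists g.
Qed.

(** Preimages under [iota] are unique, so choosing them pointwise already gives a linear map. *)
Lemma linear_factor (R : pzRingType) (L M X : lmodType R)
    (iota : {linear M -> X}) (f : {linear L -> X}) :
  injective iota -> range f `<=` range iota ->
  exists g : {linear L -> M}, forall l, iota (g l) = f l.
Proof.
move=> iota_inj f_sub.
have /choice[h hP] : forall l, exists m, iota m = f l.
  by move=> l; have [|m _ <-] := f_sub (f l); [exists l | exists m].
have [|g gE] := @ex_linear R L M h; last by exists g => l; rewrite gE.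
by move=> a u v; apply: iota_inj; rewrite linearP !hP linearP.
Qed.

Lemma linear_range_trace (R : pzRingType) (M X : lmodType R)
    (iota f : {linear M -> X}) :
  injective iota -> is_trace_via iota -> range f `<=` range iota.
Proof.
move=> iota_inj [N tr_iota] _ [m _ <-].
have [n [alpha [z mE]]] : trace_module N (iota m).
  by rewrite -tr_iota; exists m.
(* Each [alpha i] has its image in the trace of [N], which is the range of [iota], so it factors
   through [iota]. *)
have /choice[beta betaP] : forall i, exists g : {linear N -> M},
    forall l, iota (g l) = alpha i l.
  move=> i; apply: linear_factor => // _ [l _ <-].
  by rewrite tr_iota; exists 1%N, (fun=> alpha i), (fun=> l); rewrite big_ord1.
rewrite tr_iota; exists n, (fun i => f \o beta i : {linear N -> X}), z.
rewrite -linear_sum; congr (f _); apply: iota_inj.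
by rewrite mE linear_sum; apply: eq_bigr => i _; rewrite betaP.
Qed.

(** The projections are the coordinates of the inverse bijection, which is linear because the
    bijection is. *)
Lemma direct_sum_proj (R : pzRingType) (n : nat) (M : 'I_n -> lmodType R)
    (P : lmodType R) (inj : forall i, {linear M i -> P}) :
  is_direct_sum inj ->
  forall i, exists p : {linear P -> M i}, cancel (inj i) p.
Proof.
case=> g fK gK i.
have [|p pE] := @ex_linear R P (M i) (fun x => g x i).
  move=> a u v.
  rewrite -[in LHS](gK u) -[in LHS](gK v) scaler_sumr -big_split /=.
  under eq_bigr do rewrite -linearP.
  by rewrite (fK (fun j => a *: g u j + g v j)).
exists p => x; rewrite pE.
pose m : forall j, M j := dfwith (fun j => 0 : M j) x.
have -> : inj i x = \sum_(j < n) inj j (m j).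
  rewrite (bigD1 i) //= /m dfwith_in big1 ?addr0 // => j ji.
  by rewrite dfwith_out ?linear0 // eq_sym.
by rewrite (fK m) /m dfwith_in.
Qed.

Lemma binary_direct_sum (R : pzRingType) (U : subcategory R)
    (M N : lmodType R) :
  closed_under_finite_direct_sums U -> U M -> U N ->
  exists (P : lmodType R) (iM : {linear M -> P}) (iN : {linear N -> P})
      (pM : {linear P -> M}) (pN : {linear P -> N}),
    [/\ U P, cancel iM pM & cancel iN pN].
Proof.
move=> U_sums UM UN.
pose S (i : 'I_2) : lmodType R := if i == ord0 then M else N.
have US i : U (S i) by rewrite /S; case: ifP.
have [P [inj [UP /direct_sum_proj proj]]] := U_sums _ _ US.
have [pM pMK] := proj ord0; have [pN pNK] := proj ord_max.
by exists P, (inj ord0), (inj ord_max), pM, pN.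
Qed.

Theorem theorem4p3 (R : pzRingType) (U : subcategory R)
    (F : additive_functor R) (eta : nat_trans_from_id F)
    (eta_inj : forall M : lmodType R, U M -> injective (eta M))
    (R_in_U : U (R^o)%R)
    (U_sums : closed_under_finite_direct_sums U) :
  (forall M : lmodType R, U M -> is_isomorphism (eta M)) <->
  (forall M : lmodType R, U M -> is_trace_via (eta M)).
Proof.
split=> [iso M /iso [g [_ gK]]|tr M UM].
  (* The range of [eta M] is all of [F M], which is its own trace in itself by the identity map. *)
  exists (F M); rewrite eqEsubset; split=> x _; last by exists (g x).
  exists 1%N, (fun=> idfun : {linear F M -> F M}), (fun=> x).
  by rewrite big_ord1.
(* Surjectivity suffices: factoring the identity through the injective [eta M] gives a linear
   inverse. *)
suff eta_surj : range (idfun : {linear F M -> F M}) `<=` range (eta M).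
  have [g gP] := linear_factor (@eta_inj M UM) eta_surj.
  by exists g; split=> // m; apply: (eta_inj _ UM); rewrite gP.
move=> _ [x _ <-] /=.
have [P [iM [iR [pM [pR [UP pMK pRK]]]]]] := binary_direct_sum U_sums UM R_in_U.
pose y : F P := functor_map F iM x.
have [|h hE] := @ex_linear R R^o (F P) (fun r => (r : R) *: y).
  by move=> a u v; rewrite scalerDl scalerA.
have [|p _ pE] :=
    linear_range_trace (f := h \o pR) (eta_inj P UP) (tr P UP) (t := y).
  by exists (iR 1) => //=; rewrite pRK hE scale1r.
exists (pM p) => //.
(* With [F] applied to maps, [eta M (pM p) = F(pM)(eta P p) = F(pM)(y) = F(pM \o iM)(x) = F(id)(x) =
   x]. *)
have /= -> := naturality eta pM p.
rewrite pE /y -[LHS](functor_comp pM iM x).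
by rewrite (@eq_linear R M M (pM \o iM) idfun pMK) functor_id.
Qed.
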